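(* Let $X$ be a Tychonoff space. If $P(X)$ is pseudocompact, then $X^n$ is pseudocompact for all $n\in\mathbb N$.
   Context: For a Tychonoff space $X$, $P(X)$ is the set of Radon probability measures on the Borel $\sigma$-algebra of $X$ (for every Borel $B$ and $\varepsilon>0$ there is a compact $K\subset B$ with $\mu(B\setminus K)<\varepsilon$), with the weak topology, i.e. the topology generated by the functions $\mu\mapsto\int_X f\,d\mu$ for bounded continuous $f:X\to\mathbb R$. A space is pseudocompact if every continuous real-valued function on it is bounded. *)

(* Defs.v *)
From HB Require Import structures.
From mathcomp Require Import all_boot all_order all_algebra.
From mathcomp Require Import all_classical all_reals all_analysis.

Set Implicit Arguments.
Unset Strict Implicit.
Unset Printing Implicit Defensive.

Import Order.TTheory GRing.Theory Num.Theory.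
Import numFieldNormedType.Exports.

Local Open Scope classical_set_scope.
Local Open Scope ring_scope.

(* [completely_regular_space] is phrased with uniformities; by
   [uniform_separatorP] it is separation of points from closed sets by
   continuous real-valued functions. *)
Definition tychonoff_space (X : topologicalType) : Prop :=
  hausdorff_space X /\ completely_regular_space X.

Definition pseudocompact (R : realType) (X : topologicalType) : Prop :=
  forall f : X -> R, continuous f -> bounded_fun f.

Definition borel (T : ptopologicalType) := g_sigma_algebraType (@open T).

HB.instance Definition _ (T : ptopologicalType) :=
  Measurable.on (borel T).

Section Radon.
Variables (R : realType) (T : ptopologicalType).

Definition radon (mu : set T -> \bar R) : Prop :=
  forall (B : set T) (e : R), measurable (B : set (borel T)) -> 0 < e ->
    exists K : set T, [/\ compact K, K `<=` B & (mu (B `\` K) < e%:E)%E].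

(* A library measure is a function on all subsets, unconstrained off the
   sigma-algebra. Requiring the value 0 on non-Borel sets leaves exactly one
   representative of each measure on the Borel sigma-algebra. *)
Definition radon_probability :=
  {mu : probability (borel T) R | radon mu /\
    forall A : set (borel T), ~ measurable A -> mu A = 0%E}.

HB.instance Definition _ := gen_eqMixin radon_probability.
HB.instance Definition _ := gen_choiceMixin radon_probability.

Definition bounded_continuous :=
  {f : T -> R | continuous f /\ bounded_fun f}.

Definition expect (f : bounded_continuous) (mu : radon_probability) : R :=
  \int[sval mu]_x (sval f x).

Definition radon_weak : topologicalType :=
  sup_topology (fun f : bounded_continuous =>
    Topological.class (initial_topology (expect f))).

End Radon.

Definition pointed_at (X : topologicalType) (x0 : X) : Type := X.

HB.instance Definition _ (X : topologicalType) (x0 : X) :=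
  Topological.copy (pointed_at x0) X.
HB.instance Definition _ (X : topologicalType) (x0 : X) :=
  isPointed.Build (pointed_at x0) x0.

(* The library's measurable types are pointed, so [radon_weak] needs a point of
   the space; its choice is immaterial. The empty space carries no probability
   measure, and P(X) is then empty, hence homeomorphic to X itself. *)
Definition P (R : realType) (X : topologicalType) : topologicalType :=
  match pselect (exists x : X, True) with
  | left h => radon_weak R (pointed_at (projT1 (cid h)))
  | right _ => X
  end.

(* Main.v *)
(* If f is continuous and unbounded on X^n (n > 0), choose points x_k with
   |f(x_k)| > k and bump functions h_{k,i} : X -> [0, 1] with
   h_{k,i}(x_{k,i}) = 1, vanishing off open sets U_{k,i} such that |f - f(x_k)| < 1
   on the box prod_i U_{k,i}. Fix e strictly between 0 and 1/n. The functions
     g_k(mu) = prod_i max(0, int h_{k,i} dmu - e)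
   are continuous on P(X), and g_k >= (1/n - e)^n at the average of the Dirac
   masses at x_{k,1}, ..., x_{k,n}. They are also locally finite: given mu, pick a
   compact K with mu(X \ K) < e; f is bounded on V^n for some neighbourhood V of K,
   and every nu near mu gives more than 1 - e to V. If g_k(nu) <> 0 then nu gives
   more than e to every U_{k,i}, so the box meets V^n, which bounds k. Hence
   sum_k k g_k is continuous and unbounded on P(X). *)
Require Import Defs.
From HB Require Import structures.
From mathcomp Require Import all_boot all_order all_algebra finmap.
From mathcomp Require Import all_classical all_reals all_analysis.
From mathcomp Require Import measurable_realfun lra.

Set Implicit Arguments.
Unset Strict Implicit.
Unset Printing Implicit Defensive.

Import Order.TTheory GRing.Theory Num.Theory.
Import numFieldNormedType.Exports.

Local Open Scope classical_set_scope.
Local Open Scope ring_scope.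

(** * Locally finite sums on a pseudocompact space *)

(** Otherwise the sum of the [k * g k], continuous by local finiteness, would be at least [k * c] at
    some point for every [k], hence unbounded. *)
Lemma pseudocompact_locally_finite (R : realType) (T : topologicalType)
    (g : nat -> T -> R) (c : R) :
    pseudocompact R T -> 0 < c ->
    (forall k, continuous (g k)) -> (forall k t, 0 <= g k t) ->
    (forall t : T, exists N, \forall u \near t, forall k, (N <= k)%N -> g k u = 0) ->
  ~ forall k, exists t, c <= g k t.
Proof.
move=> pT c0 gc g0 /choice[N gN] gk.
(* The cutoff [N u] varies with [u]; [FE] shows that every valid cutoff gives the same value, so
   near [t] the fixed cutoff [N t] serves. *)
pose F u := \sum_(k < N u) k%:R * g k u.
have FE u M : (forall k, (M <= k)%N -> g k u = 0) ->
    F u = \sum_(k < M) k%:R * g k u.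
  move=> gM; have tail0 a b : (forall k, (a <= k)%N -> g k u = 0) ->
      \sum_(a <= k < b) k%:R * g k u = 0.
    by move=> ga; rewrite big_nat big1// => k /andP[/ga -> _]; rewrite mulr0.
  have gNu := nbhs_singleton (gN u).
  rewrite /F -!(big_mkord xpredT (fun k => k%:R * g k u)).
  have [lMN|/ltnW lNM] := leqP M (N u).
    by rewrite (big_cat_nat (n := M) (p := N u))//= (tail0 M)// addr0.
  by rewrite [RHS](big_cat_nat (n := N u) (p := M))//= (tail0 (N u))// addr0.
have Fc : continuous F.
  move=> t; rewrite /continuous_at.
  rewrite (FE t (N t) (nbhs_singleton (gN t))).
  apply: (@cvg_trans _ ((fun u => \sum_(k < N t) k%:R * g k u) @ t)).
    apply: near_eq_cvg; near=> u; apply/esym/FE.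
    by near: u; exact: gN.
  apply: cvg_big => [|k _]; first exact: add_continuous.
  apply: cvgM; [exact: cvg_cst | exact: gc].
have [M [_ FM]] := pT F Fc.
have /FM FM1 : M < `|M| + 1 by rewrite (le_lt_trans (ler_norm _))// ltrDl.
(* [|M| + 1] bounds [F], and this [k] makes [k * c] exceed it. *)
pose k := (Num.bound ((`|M| + 1) / c)).
have [t ct] := gk k.
(* Since [g k t] is positive, the cutoff at [t] lies beyond [k] and the [k]-th term occurs in
   [F t]. *)
have kN : (k < N t)%N.
  rewrite ltnNge; apply/negP => /(nbhs_singleton (gN t)) gkt.
  by move: ct; rewrite gkt leNgt c0.
have : k%:R * c <= F t.
  rewrite /F (bigD1 (Ordinal kN))//= (le_trans (ler_wpM2l _ ct))// lerDl.
  by apply: sumr_ge0 => i _; rewrite mulr_ge0.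
have : (`|M| + 1) / c < k%:R by apply: archi_boundP; rewrite divr_ge0// ltW.
rewrite ltr_pdivrMr// => h1 h2.
have := FM1 t Logic.I => /=.
have := ler_norm (F t); lra.
Unshelve. all: by end_near. Qed.

(** * Compactness and boxes in products *)

Lemma compact_nbhs_cover (T : topologicalType) (K : set T) (U : T -> set T) :
    compact K -> (forall x, K x -> nbhs x (U x)) ->
  exists2 D : {fset T}%fset, (forall x, x \in D -> K x) &
    forall y, K y -> exists2 x, x \in D & U x y.
Proof.
move=> cK KU; have [[x0 _]|nT] := pselect (exists x : T, True); last first.
  by exists fset0 => // y; case: nT; exists y.
have : @compact (pointed_at x0) K := cK.
rewrite compact_cover => /(_ T K (fun x => (U x)^°)) [x _||D DK KD].
- exact: open_interior.
- by move=> x Kx; exists x => //; exact: KU.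
exists D => [x /DK|y /KD[x xD Uxy]]; first by rewrite inE.
by exists x => //; exact: interior_subset Uxy.
Qed.

(** The sets containing a box around [y] form a filter. The product topology is a supremum of
    initial topologies, so this filter converges to [y] once it does so in each coordinate, where a
    box constraining that coordinate alone suffices. *)
Lemma nbhs_box (I : finType) (T : I -> topologicalType) (y : prod_topology T)
    (A : set (prod_topology T)) :
  nbhs y A -> exists B : forall i, set (T i),
    (forall i, open_nbhs (y i) (B i)) /\
    (forall v : prod_topology T, (forall i, B i (v i)) -> A v).
Proof.
pose box := [set B : forall i, set (T i) | forall i, nbhs (y i) (B i)].
pose F : set_system (prod_topology T) :=
  filter_from box (fun B => [set v | forall i, B i (v i)]).
have FF : Filter F.
  apply: filter_from_filter; first by exists (fun=> setT) => i; exact: filterT.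
  move=> B C bB bC; exists (fun i => B i `&` C i) => [i|v /= vBC].
    by apply: filterI; [exact: bB|exact: bC].
  by split => i; case: (vBC i).
have cF : F --> y.
  apply/cvg_sup => i A'.
  rewrite nbhsE => -[V [[W oW <-] /= Wy] VA'].
  exists (dfwith (fun=> setT) i W) => [j|v /= vW].
    case: dfwithP => [|k _]; last exact: filterT.
    by apply: open_nbhs_nbhs; split.
  by apply: VA' => /=; have := vW i; rewrite dfwithin.
move=> /cF[B bB BA]; exists (fun i => (B i)^°); split => [i|v Bv].
  by split; [exact: open_interior|exact: bB].
by apply: BA => i; exact: interior_subset.
Qed.

(* By compactness K^I is covered by finitely many boxes on which f is bounded; V
   is the set of v for which some x in K has all its box sides also containing v. *)
Lemma compact_bounded_near_power (R : realType) (X : topologicalType)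
    (I : finType) (f : prod_topology (fun _ : I => X) -> R) (K : set X) :
    continuous f -> compact K ->
  exists (V : set X) (C : R), (forall x, K x -> nbhs x V) /\
    forall v : prod_topology (fun _ : I => X),
      (forall i, V (v i)) -> `|f v| <= C.
Proof.
move=> fc cK.
have cKI := tychonoff (fun _ : I => cK).
have [C [_ fC]] : bounded_set (f @` [set v : prod_topology (fun _ : I => X) |
    forall i, K (v i)]).
  by apply/compact_bounded/continuous_compact => //; exact: continuous_subspaceT.
have C1 : C < `|C| + 1 by rewrite (le_lt_trans (ler_norm _))// ltrDl.
have /choice[B BP] (y : prod_topology (fun _ : I => X)) :
    exists B : I -> set X, (forall i, open_nbhs (y i) (B i)) /\
      forall v : prod_topology (fun _ : I => X),
        (forall i, B i (v i)) -> `|f v - f y| < 1.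
  apply: nbhs_box.
  have /cvgrPdistC_lt := fc y; apply.
  exact: ltr01.
have nB (y : prod_topology (fun _ : I => X)) :
    nbhs y [set v : prod_topology (fun _ : I => X) | forall i, B y i (v i)].
  apply: (@filter_forall _ I (fun i v => B y i (v i)) _ (nbhs_filter y)) => i.
  have := @proj_continuous I (fun=> X) i y (B y i); apply.
  by apply: open_nbhs_nbhs; exact: (BP y).1.
have [D DK KD] := compact_nbhs_cover cKI (fun y _ => nB y).
(* A centre [y] lies in K^I, so [|f y|] is at most [|C| + 1], and [f] differs from [f y] by less
   than 1 on the box of [y]. *)
exists [set v | exists2 x, K x & forall y, y \in D -> forall i,
    B y i x -> B y i v], (`|C| + 1 + 1); split=> [x Kx|v Vv].
  suff : \forall v \near x, forall y, y \in D -> forall i, B y i x -> B y i v.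
    by apply: filterS => v; exists x.
  (* Only finitely many conditions arise, as [D] and [I] are finite; a side that misses [x] imposes
     none. *)
  pose S y := [set v | forall i, B y i x -> B y i v].
  have : nbhs x (\bigcap_(y in [set` D]) S y).
    apply: filter_bigI => y _; apply: filter_forall => i.
    have [Byx|nByx] := pselect (B y i x); last exact: nearW.
    apply: filterS (_ : nbhs x (B y i)) => //.
    by apply: open_nbhs_nbhs; split => //; have [] := (BP y).1 i.
  by apply: filterS => v Sv y yD; exact: Sv.
(* Replacing each [v i] by its witness in [K] gives a point of K^I; a box of the finite cover
   containing that point also contains [v]. *)
have /choice[x xP] (i : I) : exists x, K x /\ forall y, y \in D -> forall j,
    B y j x -> B y j (v i) by have [x Kx xB] := Vv i; exists x; split.
have [y yD yx] := KD x (fun i => (xP i).1).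
have fvy : `|f v - f y| < 1.
  by apply: (BP y).2 => i; exact: (xP i).2 y yD i (yx i).
have fy : `|f y| <= `|C| + 1 by apply: fC => //; exists y => //; exact: DK.
have := ler_normD (f v - f y) (f y); rewrite subrK; lra.
Qed.

(** * Bump functions at points and on compact sets *)

Lemma completely_regular_bump (R : realType) (X : topologicalType) (x : X)
    (U : set X) : completely_regular_space X -> nbhs x U ->
  exists h : X -> R, [/\ continuous h, forall y, 0 <= h y <= 1, h x = 1 &
    forall y, ~ U y -> h y = 0].
Proof.
move=> crX xU.
have /(@uniform_separatorP _ R)[h [hc h01 hx hU]] :
    uniform_separator [set x] (~` U^°).
  by apply: crX; [apply: open_closedC; exact: open_interior|exact].
(* The separator is 0 at [x] and 1 off the interior of [U], hence the reflection. *)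
exists (fun y => 1 - h y); split.
- by move=> y; apply: cvgB; [exact: cvg_cst|exact: hc].
- move=> y; have /= := h01 (h y) (ex_intro2 _ _ y Logic.I erefl).
  by rewrite in_itv/= => /andP[]; lra.
- have -> : h x = 0 by apply: hx; exists x.
  by rewrite subr0.
- move=> y Uy; have -> : h y = 1.
    by apply: hU; exists y => // /interior_subset.
  by rewrite subrr.
Qed.

(** Finitely many point bumps suffice for one of them to exceed 1/2 at each point of [K]; doubling,
    summing and truncating at 1 gives the value 1 on all of [K]. *)
Lemma completely_regular_compact_bump (R : realType) (X : topologicalType)
    (K V : set X) :
    completely_regular_space X -> compact K -> (forall x, K x -> nbhs x V) ->
  exists h : X -> R, [/\ continuous h, forall y, 0 <= h y <= 1,
    forall x, K x -> h x = 1 & forall y, ~ V y -> h y = 0].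
Proof.
move=> crX cK KV.
have /choice[h hP] x : exists h : X -> R, [/\ continuous h,
    forall y, 0 <= h y <= 1, K x -> h x = 1 & forall y, ~ V y -> h y = 0].
  have [Kx|nKx] := pselect (K x).
    have [h [? ? ? ?]] := completely_regular_bump R crX (KV x Kx).
    by exists h.
  (* Zero is the default off [K], so that the choice runs over all points. *)
  exists (fun=> 0); split => // [y|y]; first exact: cvg_cst.
  by rewrite lexx ler01.
have Kh x : K x -> nbhs x [set y | K x -> 2^-1 < h x y].
  move=> Kx; have [hc _ /(_ Kx) hx _] := hP x.
  have : \forall y \near x, 2^-1 < h x y.
    by have /cvgr_gt := hc x; apply; rewrite hx; lra.
  by apply: filterS => y hy _.
have [D DK KD] := compact_nbhs_cover cK Kh.
exists (fun y => Num.min 1 (\sum_(x <- D) 2 * h x y)); split.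
- move=> y; apply: continuous_min; first exact: cvg_cst.
  apply: cvg_big => [|x _]; first exact: add_continuous.
  apply: cvgM; first exact: cvg_cst.
  by have [hc _ _ _] := hP x; exact: hc.
- move=> y; rewrite ge_min lexx/= le_min ler01/= sumr_ge0// => x _.
  by have [_ /(_ y)/andP[h0 _] _ _] := hP x; rewrite mulr_ge0.
- move=> y /KD[x xD /(_ (DK _ xD)) hxy]; apply/min_idPl.
  rewrite (bigD1_seq x)//= (le_trans (_ : _ <= 2 * h x y))//; first lra.
  rewrite lerDl sumr_ge0// => z _.
  by have [_ /(_ y)/andP[h0 _] _ _] := hP z; rewrite mulr_ge0.
- move=> y Vy; rewrite big1 ?minr0// => [|x _].
    by apply/min_idPr.
  by have [_ _ _ ->//] := hP x; rewrite mulr0.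
Qed.

(** * Averages of Dirac masses *)

(* [radon_probability] only accepts measures that vanish off the sigma-algebra. *)
Section null_off_measurable.
Local Open Scope ereal_scope.
Context d (T : measurableType d) (R : realType) (m : probability T R).

Definition null_off_measurable (A : set T) : \bar R :=
  if `[< measurable A >] then m A else 0.

Lemma null_off_measurableE (A : set T) :
  measurable A -> null_off_measurable A = m A.
Proof. by rewrite /null_off_measurable => mA; rewrite asboolT. Qed.

Let null_off_measurable0 : null_off_measurable set0 = 0.
Proof. by rewrite null_off_measurableE. Qed.

Let null_off_measurable_ge0 A : 0 <= null_off_measurable A.
Proof. by rewrite /null_off_measurable; case: ifP. Qed.

Let null_off_measurable_sigma_additive : semi_sigma_additive null_off_measurable.
Proof.
move=> F mF tF mUF; rewrite null_off_measurableE//.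
rewrite (_ : (fun n => _) = (fun n => \sum_(0 <= i < n) m (F i))).
  exact: measure_semi_sigma_additive.
by apply/funext => n; apply: eq_bigr => i _; rewrite null_off_measurableE.
Qed.

HB.instance Definition _ := isMeasure.Build _ _ _ null_off_measurable
  null_off_measurable0 null_off_measurable_ge0
  null_off_measurable_sigma_additive.

Let null_off_measurableT : null_off_measurable setT = 1.
Proof. by rewrite null_off_measurableE// probability_setT. Qed.

HB.instance Definition _ :=
  Measure_isProbability.Build _ _ _ null_off_measurable null_off_measurableT.

End null_off_measurable.

Section uniform_atoms.
Local Open Scope ereal_scope.
Context d (T : measurableType d) (R : realType) (n : nat) (x : 'I_n.+1 -> T).

(** The average of the Dirac masses at the [x i], repetitions counted; [inord] converts the
    natural-number index of [msum]. *)
Definition uniform_atoms : set T -> \bar R :=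
  mscale ((n.+1%:R^-1)%:nng)%R (msum (fun k => \d_(x (inord k))) n.+1).

HB.instance Definition _ := Measure.on uniform_atoms.

Lemma uniform_atomsE (A : set T) :
  uniform_atoms A = (n.+1%:R^-1 * \sum_(i < n.+1) \1_A (x i))%R%:E.
Proof.
rewrite /uniform_atoms /mscale/= /msum EFinM -sumEFin; congr (_ * _).
by apply: eq_bigr => i _; rewrite inord_val.
Qed.

Let uniform_atomsT : uniform_atoms setT = 1.
Proof.
rewrite uniform_atomsE (eq_bigr (fun=> 1%R)) => [|i _].
  by rewrite sumr_const card_ord mulVf// pnatr_eq0.
by rewrite indicT.
Qed.

HB.instance Definition _ :=
  Measure_isProbability.Build _ _ _ uniform_atoms uniform_atomsT.

Lemma integral_uniform_atoms (f : T -> R) :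
    measurable_fun setT f -> (forall t, 0 <= f t)%R ->
  \int[uniform_atoms]_t (f t)%:E = (n.+1%:R^-1 * \sum_(i < n.+1) f (x i))%R%:E.
Proof.
move=> /measurable_EFinP mf f0.
rewrite ge0_integral_mscale//; last by move=> t _; rewrite lee_fin.
rewrite ge0_integral_measure_sum//; last by move=> t _; rewrite lee_fin.
rewrite EFinM -sumEFin; congr (_ * _).
apply: eq_bigr => i _; rewrite integral_dirac//.
by rewrite diracT mul1e inord_val.
Qed.

End uniform_atoms.

(** * Radon probabilities and expectations *)

Lemma measurable_borel_continuous (R : realType) (T : ptopologicalType)
    (f : T -> R) : continuous f -> measurable_fun setT (f : borel T -> R).
Proof.
move=> /continuousP cf; apply: (measurability _ (RGenOpens.measurableE R)).
move=> _ [_ [a [b ->] <-]]; rewrite setTI.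
by apply: sub_sigma_algebra; apply: cf; exact: interval_open.
Qed.

Section radon_probability.
Variables (R : realType) (T : ptopologicalType).
Hypothesis T2 : hausdorff_space T.

Lemma compact_measurable_borel (K : set T) :
  compact K -> measurable (K : set (borel T)).
Proof.
move=> cK; rewrite -[K]setCK; apply: measurableC; apply: sub_sigma_algebra.
by apply: closed_openC; exact: compact_closed.
Qed.

(** For the average of the Dirac masses, the expectation of [h] is the mean of the [h (x i)], which
    is at least any one of its nonnegative summands. *)
Lemma exists_radon_uniform_atoms (n : nat) (x : 'I_n.+1 -> T) :
  exists mu : radon_probability R T, forall (h : bounded_continuous R T) i,
    (forall t, 0 <= sval h t) -> n.+1%:R^-1 * sval h (x i) <= expect h mu.
Proof.
pose m : probability (borel T) R := uniform_atoms R (x : 'I_n.+1 -> borel T).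
pose mu : probability (borel T) R := null_off_measurable m.
have rmu : radon mu.
  (* The atoms lying in [B] form a finite, hence compact, set carrying all the mass of [B]. *)
  move=> B e mB e0; pose K := B `&` range x.
  have cK : compact K.
    by apply: finite_compact; apply: finite_setIr; exact: finite_image.
  exists K; split => //; first exact: subIsetl.
  rewrite /= null_off_measurableE; last first.
    by apply: measurableD => //; exact: compact_measurable_borel.
  rewrite /m/= uniform_atomsE big1 ?mulr0// => i _.
  by rewrite indicE memNset// => -[Bx []]; split => //; exists i.
have mu0 (A : set (borel T)) : ~ measurable A -> mu A = 0%E.
  by move=> mA; rewrite /mu/= /null_off_measurable asboolF.
exists (exist _ mu (conj rmu mu0)) => h i h0.
rewrite /expect/= /Rintegral.
rewrite (eq_measure_integral m); last first.
  by move=> A mA _; exact: null_off_measurableE.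
rewrite integral_uniform_atoms//; last first.
  exact: measurable_borel_continuous (svalP h).1.
by rewrite ler_wpM2l// (bigD1 i)//= lerDl sumr_ge0.
Qed.

Lemma integrable_bounded_continuous (mu : probability (borel T) R)
    (f : T -> R) : continuous f -> bounded_fun f ->
  mu.-integrable setT (EFin \o (f : borel T -> R)).
Proof.
move=> cf bf; apply: measurable_bounded_integrable => //.
  by apply: le_lt_trans (ltry 1); exact: probability_le1.
exact: measurable_borel_continuous.
Qed.

(** The indicator of [K] lies below [h], so the expectation is at least the mass of [K]. *)
Lemma expect_bump_gt (mu : radon_probability R T) (K : set T) (e : R)
    (h : bounded_continuous R T) :
    compact K -> (sval mu (~` K) < e%:E)%E -> (forall t, 0 <= sval h t) ->
    (forall t, K t -> sval h t = 1) ->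
  1 - e < expect h mu.
Proof.
move=> cK muK h0 h1; have mK := compact_measurable_borel cK.
have : (sval mu K <= \int[sval mu]_t (sval h t)%:E)%E.
  have <- : (\int[sval mu]_t (\1_K t)%:E)%E = sval mu K.
    by rewrite integral_indic ?setIT.
  apply: ge0_le_integral => //.
  - by apply/measurable_EFinP; exact: measurable_indic.
  - by apply/measurable_EFinP; exact: measurable_borel_continuous (svalP h).1.
  - move=> t _; rewrite lee_fin indicE.
    by have [/set_mem/h1->|] := boolP (t \in K).
have := @integrable_bounded_continuous (sval mu) _ (svalP h).1 (svalP h).2.
move=> /(integrable_fin_num measurableT)/= ifin.
move: muK; rewrite probability_setC// /expect /Rintegral.
have /fineK <- : sval mu K \is a fin_num by exact: fin_num_measure.
rewrite -[in X in _ -> X](fineK ifin) -EFinB lte_fin lee_fin; lra.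
Qed.

(** Meant for two bumps that are never nonzero together: their expectations cannot exceed [1 - e]
    and [e] respectively. *)
Lemma expectD_le1 (mu : radon_probability R T) (g h : bounded_continuous R T) :
  (forall t, sval g t + sval h t <= 1) -> expect g mu + expect h mu <= 1.
Proof.
move=> gh1; have [[cg bg] [ch bh]] := (svalP g, svalP h).
rewrite /expect -RintegralD//; [|exact: integrable_bounded_continuous..].
have <- : \int[sval mu]_(_ in setT) (1 : R) = 1.
  rewrite Rintegral_cst// mul1r -[RHS]/(fine 1%E); congr fine.
  exact: probability_setT.
apply: le_Rintegral => //.
- have -> : EFin \o (fun t => sval g t + sval h t) =
     (EFin \o sval g) \+ (EFin \o sval h) by [].
  by apply: integrableD => //; exact: integrable_bounded_continuous.
- exact: finite_measure_integrable_cst.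
Qed.

Lemma expect_continuous (h : bounded_continuous R T) :
  continuous (expect h : radon_weak R T -> R).
Proof.
move=> mu; have /cvg_sup/(_ h) mu_h : nbhs mu --> mu by exact: cvg_id.
by move=> A hA; apply: mu_h; exact: (@initial_continuous _ _ (expect h) mu A hA).
Qed.

End radon_probability.

(** * From the space of measures to powers *)

Lemma pseudocompact_power_of_radon_weak (R : realType) (T : ptopologicalType)
    (n : nat) :
    hausdorff_space T -> completely_regular_space T ->
    pseudocompact R (radon_weak R T) ->
  pseudocompact R (prod_topology (fun _ : 'I_n.+1 => T)).
Proof.
move=> T2 crT pP f fc; apply: contrapT => nbf.
have /choice[x xk] k : exists x, k%:R < `|f x|.
  apply: contrapT => /forallNP fk; apply: nbf; exists k%:R; split => //.
  move=> M kM v _ /=; have /negP := fk v.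
  by rewrite -leNgt => /le_trans -> //; exact: ltW.
have /choice[U UP] k : exists U : 'I_n.+1 -> set T,
    (forall i, open_nbhs (x k i) (U i)) /\
    forall v : prod_topology (fun _ : 'I_n.+1 => T),
      (forall i, U i (v i)) -> `|f v - f (x k)| < 1.
  apply: nbhs_box.
  have /cvgrPdistC_lt := fc (x k); apply.
  exact: ltr01.
have /choice[h hP] (p : nat * 'I_n.+1) : exists h : bounded_continuous R T,
    [/\ forall y, 0 <= sval h y <= 1, sval h (x p.1 p.2) = 1 &
      forall y, ~ U p.1 p.2 y -> sval h y = 0].
  have [h [hc h01 hx hU]] := completely_regular_bump R crT
    (open_nbhs_nbhs ((UP p.1).1 p.2)).
  have bh : bounded_fun h.
    exists 1; split => // M M1 y _ /=; have /andP[h0 h1] := h01 y.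
    by rewrite ger0_norm// (le_trans h1)// ltW.
  by exists (exist _ h (conj hc bh)).
(* The power has [n.+1] factors, so each atom will weigh 1/(n+1), and 1/(n+2) is a positive number
   below that. *)
pose eps : R := n.+2%:R^-1.
have eps0 : 0 < eps by rewrite invr_gt0.
have epsn : eps < n.+1%:R^-1 by rewrite ltf_pV2 ?posrE// ltr_nat.
have cvg_excess (Y : topologicalType) (e : Y -> R) : continuous e ->
    continuous (fun y => Num.max 0 (e y - eps)).
  move=> ec y; apply: (@continuous_max R Y (cst 0) (fun y => e y - eps)).
    exact: cvg_cst.
  by apply: cvgB; [exact: ec|exact: cvg_cst].
pose g k (mu : radon_weak R T) :=
  \prod_(i < n.+1) Num.max 0 (expect (h (k, i)) mu - eps).
apply: (@pseudocompact_locally_finite R (radon_weak R T) g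
  ((n.+1%:R^-1 - eps) ^+ n.+1) pP).
- by rewrite exprn_gt0// subr_gt0.
- move=> k; apply: continuous_big => [|i _]; first exact: mul_continuous.
  apply: (@cvg_excess (radon_weak R T)); exact: expect_continuous.
- by move=> k mu; apply: prodr_ge0 => i _; rewrite le_max lexx.
- move=> mu; have [rmu _] := svalP mu.
  have [K [cK _ muK]] := rmu setT eps measurableT eps0.
  have [V [C [KV fV]]] := compact_bounded_near_power fc cK.
  have [u [uc u01 uK uV]] := completely_regular_compact_bump R crT cK KV.
  have bu : bounded_fun u.
    exists 1; split => // M M1 y _ /=; have /andP[u0 u1] := u01 y.
    by rewrite ger0_norm// (le_trans u1)// ltW.
  pose w : bounded_continuous R T := exist _ u (conj uc bu).
  have muw : 1 - eps < expect w mu.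
    apply: (expect_bump_gt T2 cK) => //; first by rewrite -setTD.
    by move=> t; have /andP[] := u01 t.
  (* A point [v] in both V^(n+1) and the [k]-th box gives [k < |f (x k)| < |f v| + 1 <= C + 1],
     impossible from this index on. *)
  exists (Num.bound (`|C| + 1)).
  have : \forall nu \near mu, 1 - eps < expect w nu.
    by have /cvgr_gt := @expect_continuous R T w mu; exact.
  apply: filterS => nu nuw k Nk; apply: contrapT => gk.
  have hk i : eps < expect (h (k, i)) nu.
    rewrite ltNge; apply/negP => hi; apply: gk.
    rewrite /g (bigD1 i)//= (_ : Num.max _ _ = 0) ?mul0r//.
    by apply/max_idPl; rewrite subr_le0.
  (* If [V] missed [U k i], then [w] and [h (k, i)] would sum to at most 1 everywhere, yet their
     expectations exceed [1 - eps] and [eps]. *)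
  have /choice[v vP] i : exists y, V y /\ U k i y.
    apply: contrapT => /forallNP VU.
    have : expect w nu + expect (h (k, i)) nu <= 1.
      apply: expectD_le1 => t /=; have [/(_ t)/andP[_ h1] _ hU] := hP (k, i).
      have [Vt|/uV->] := pselect (V t); last by rewrite add0r.
      rewrite hU ?addr0 => [|Ut]; first by have /andP[] := u01 t.
      by apply: (VU t).
    by have := hk i; lra.
  have := (UP k).2 v (fun i => (vP i).2).
  have := fV v (fun i => (vP i).1); have := xk k.
  have : `|C| + 1 < (Num.bound (`|C| + 1))%:R by exact: archi_boundP.
  have : (Num.bound (`|C| + 1))%:R <= k%:R :> R by rewrite ler_nat.
  have := ler_norm C.
  have := ler_normB (f v) (f v - f (x k)); rewrite opprB addrC subrK; lra.
- move=> k; have [mu muP] := exists_radon_uniform_atoms R T2 (x k).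
  exists mu; have -> : (n.+1%:R^-1 - eps) ^+ n.+1 =
      \prod_(i < n.+1) (n.+1%:R^-1 - eps) by rewrite prodr_const card_ord.
  apply: ler_prod => i _; apply/andP; split; first by rewrite subr_ge0 ltW.
  rewrite le_max lerD2r.
  have [h01 hx _] := hP (k, i).
  have := muP (h (k, i)) i; rewrite hx mulr1 => ->; first by rewrite orbT.
  by move=> t; have /andP[] := h01 t.
Qed.

Theorem theorem1p8 (R : realType) (X : topologicalType)
    (hX : tychonoff_space X) (hP : pseudocompact R (P R X)) :
  forall n : nat, pseudocompact R (prod_topology (fun _ : 'I_n => X)).
Proof.
case: hX => X2 crX [|n].
  (* The zeroth power has exactly one point, even when [X] is empty. *)
  move=> f _; pose v0 (i : 'I_0) : X := False_rect X (notF (ltn_ord i)).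
  exists `|f v0|; split => // M /ltW fM v _ /=.
  by have -> : v = v0 by apply/(@funext _ X) => -[].
move: hP; rewrite /P; case: pselect => [[x0 tt] hP|nX _ f _].
  exact: (@pseudocompact_power_of_radon_weak R (pointed_at _) n X2 crX hP).
(* With [X] empty, a positive power is empty too, so any bound works. *)
by exists 0; split => // M _ v _; case: nX; exists (v ord0).
Qed.
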